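(* Let $(u,v)$ be a symmetric $\mathcal{T}_\mu$-coherent pair of positive measures with monic orthogonal polynomials $\{P_n\}_{n\ge 0}$ and $\{R_n\}_{n\ge 0}$ respectively, let $\lambda>0$, and let $\{S_n^{(\lambda,\mu)}\}_{n\ge 0}$ be the monic polynomials orthogonal with respect to $\langle p,q\rangle_{s,\mu}=\langle u,pq\rangle+\lambda\langle v,\mathcal{T}_\mu p\,\mathcal{T}_\mu q\rangle$. Let $f\in \mathcal{W}_2^1(\mathbb{R},u,v,\mu)$, put $f_n^{(\lambda,\mu)}=\langle f,S_n^{(\lambda,\mu)}\rangle_{s,\mu}$, and $$w_n^\mu(f)=\langle u,(P_{n+2}+a_{n-1}P_n)f\rangle+\lambda\langle v,(\mathcal{T}_\mu P_{n+2}+a_{n-1}\mathcal{T}_\mu P_n)\,\mathcal{T}_\mu f\rangle,\qquad n\ge 0.$$ Then $$f_{n+2}^{(\lambda,\mu)}+\eta_{n-1}^\mu(\lambda)\,f_n^{(\lambda,\mu)}=w_n^\mu(f),\qquad n\ge 0,$$ with initial conditions $\eta_{-1}^\mu(\lambda)=0$, $$f_0^{(\lambda,\mu)}=\langle f,1\rangle_{s,\mu}=\langle u,f\rangle,\qquad f_1^{(\lambda,\mu)}=\langle u,xf\rangle+\lambda\mu_1\langle v,\mathcal{T}_\mu f\rangle,$$ and $$w_0^\mu(f)=\langle u,P_2f\rangle+\lambda\langle v,\mathcal{T}_\mu P_2\,\mathcal{T}_\mu f\rangle .$$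
   Context: Let $\mu$ be a real number with $\mu\ne -n-\tfrac12$ for all integers $n\ge 0$. The Dunkl operator is $\mathcal{T}_\mu f(x)=f'(x)+2\mu\,\dfrac{f(x)-f(-x)}{2x}$ (with the value at $x=0$ obtained by continuity), applied to polynomials and to smooth functions. Put $\mu_n=n+\mu(1-(-1)^n)$, so $\mu_{2n}=2n$ and $\mu_{2n-1}=2n-1+2\mu$; then $\mathcal{T}_\mu x^n=\mu_n x^{n-1}$. A positive measure $u$ on the real line (with finite moments and infinite support) is identified with $\langle u,f\rangle=\int f\,du$ and is taken normalized, $\langle u,1\rangle=1$. It is symmetric if its support is symmetric and all its odd moments vanish. A pair $(u,v)$ of symmetric measures with monic orthogonal polynomials $\{P_n\}$ and $\{R_n\}$ respectively is a symmetric $\mathcal{T}_\mu$-coherent pair if there is a sequence of non-zero complex numbers $\{\sigma_n\}_{n\ge1}$ such that $R_n=\frac{\mathcal{T}_\mu P_{n+1}}{\mu_{n+1}}-\sigma_{n-1}\frac{\mathcal{T}_\mu P_{n-1}}{\mu_{n-1}}$ for all $n\ge 2$. Notation: $\varepsilon_n=-\sigma_{n+1}$ for $n\ge 0$; $p_n=\langle u,P_n^2\rangle$; $s_n^{(\lambda,\mu)}=\langle S_n^{(\lambda,\mu)},S_n^{(\lambda,\mu)}\rangle_{s,\mu}$; for $n\ge 2$, $a_{n-2}=\frac{\mu_{n+1}}{\mu_{n-1}}\varepsilon_{n-2}$ and $\eta_{n-2}^\mu(\lambda)=\frac{p_{n-1}}{s_{n-1}^{(\lambda,\mu)}}a_{n-2}$;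 by convention $\varepsilon_{-1}=a_{-1}=\eta_{-1}^\mu(\lambda)=0$. The Dunkl-Sobolev space $\mathcal{W}_2^1(\mathbb{R},u,v,\mu)$ is the set of (suitably smooth, real-valued) functions $f$ with $\|f\|_u^2+\lambda\|\mathcal{T}_\mu f\|_v^2<\infty$, where $\|g\|_u^2=\langle u,g^2\rangle$ and $\|g\|_v^2=\langle v,g^2\rangle$. The bilinear form $\langle\cdot,\cdot\rangle_{s,\mu}$ is extended to such functions by the same formula. *)

(* Defs.v *)
From HB Require Import structures.
From mathcomp Require Import all_boot all_order all_algebra.
From mathcomp Require Import all_classical all_reals all_analysis.
From mathcomp Require Import complex.

Set Implicit Arguments.
Unset Strict Implicit.
Unset Printing Implicit Defensive.

Import Order.TTheory GRing.Theory Num.Theory.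
Import numFieldNormedType.Exports.

Local Open Scope classical_set_scope.
Local Open Scope ring_scope.
Local Open Scope complex_scope.

Section Dunkl.
Context {K : realType}.
Implicit Types (mu lam : K) (f g : K -> K) (n : nat) (P Q R S : nat -> {poly K}).

(* The value at 0 is the extension by continuity, hence [dunkl mu f 0] is
   (1 + 2 mu) f'(0) when f is differentiable at 0. *)
Definition odd_quotient f (x : K) : K :=
  if x == 0 then lim ((f y - f (- y)) / (2 * y) @[y --> (0 : K)^'])
  else (f x - f (- x)) / (2 * x).

Definition dunkl mu f : K -> K :=
  fun x => derive1 f x + 2 * mu * odd_quotient f x.

Definition dunkl_admissible mu : Prop :=
  forall n, mu != - n%:R - 2^-1.

Definition dunkl_num mu n : K := n%:R + mu * (1 - (-1) ^+ n).

Notation msr := (probability (measurableTypeR K) K).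
Implicit Types u v : msr.

Definition msupport u : set K :=
  [set x | forall U : set K, open U -> U x -> (0 < u U)%E].

Definition has_finite_moments u : Prop :=
  forall n, u.-integrable setT (fun x : K => (x ^+ n)%:E).

Definition pairing u (g : K -> K) : K := \int[u]_x g x.

Definition cpairing u (g : K -> K[i]) : K[i] :=
  pairing u (fun x => complex.Re (g x)) +i* pairing u (fun x => complex.Im (g x)).

Definition symmetric_measure u : Prop :=
  (forall x, msupport u x -> msupport u (- x)) /\
  (forall n, pairing u (fun x => x ^+ n.*2.+1) = 0).

(* The normalization <u, 1> = 1 is carried by the type [probability]. *)
Definition admissible_measure u : Prop :=
  [/\ has_finite_moments u, infinite_set (msupport u) & symmetric_measure u].

Definition sobolev mu lam u v f g : K :=
  pairing u (fun x => f x * g x)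
  + lam * pairing v (fun x => dunkl mu f x * dunkl mu g x).

Definition monic_orthogonal (B : (K -> K) -> (K -> K) -> K) P : Prop :=
  (forall n, P n \is monic /\ size (P n) = n.+1) /\
  (forall m n, m != n -> B (horner (P m)) (horner (P n)) = 0).

Definition monic_OPS u P : Prop :=
  monic_orthogonal (fun f g => pairing u (fun x => f x * g x)) P.

Definition monic_sobolev_OPS mu lam u v S : Prop :=
  monic_orthogonal (sobolev mu lam u v) S.

(* sigma 0 is irrelevant: the coherence sequence is indexed from 1. *)
Definition symmetric_coherent_pair mu u v P R (sigma : nat -> K[i]) : Prop :=
  [/\ admissible_measure u, admissible_measure v,
      monic_OPS u P, monic_OPS v R &
      (forall n, (1 <= n)%N -> sigma n != 0) /\
      (forall n, (2 <= n)%N -> forall x : K,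
         ((R n).[x])%:C =
           (dunkl mu (horner (P n.+1)) x / dunkl_num mu n.+1)%:C
           - sigma n.-1 *
             (dunkl mu (horner (P n.-1)) x / dunkl_num mu n.-1)%:C)].

(* Differentiability everywhere is the least smoothness for which [dunkl mu f]
   is defined at every point. *)
Definition sobolev_space mu lam u v : set (K -> K) :=
  [set f : K -> K | (forall x : K, derivable f x 1) /\
     (\int[u]_x ((f x) ^+ 2)%:E
      + lam%:E * \int[v]_x ((dunkl mu f x) ^+ 2)%:E < +oo)%E].

Definition eps_coef (sigma : nat -> K[i]) n : K[i] := - sigma n.+1.

Definition a_coef mu sigma n : K[i] :=
  (dunkl_num mu n.+3 / dunkl_num mu n.+1)%:C * eps_coef sigma n.

Definition eta_coef mu lam u v P S sigma n : K[i] :=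
  (pairing u (fun x => (P n.+1).[x] ^+ 2)
   / sobolev mu lam u v (horner (S n.+1)) (horner (S n.+1)))%:C
  * a_coef mu sigma n.

(* [lag s n] is s_{n-1}, with the convention s_{-1} = 0. *)
Definition lag (s : nat -> K[i]) n : K[i] := if n is m.+1 then s m else 0.

Definition sobolev_coef mu lam u v S f n : K :=
  sobolev mu lam u v f (horner (S n)).

Definition w_coef mu lam u v P sigma f n : K[i] :=
  let a := lag (a_coef mu sigma) n in
  cpairing u (fun x =>
    (((P n.+2).[x])%:C + a * ((P n).[x])%:C) * (f x)%:C)
  + lam%:C * cpairing v (fun x =>
    ((dunkl mu (horner (P n.+2)) x)%:C + a * (dunkl mu (horner (P n)) x)%:C)
    * (dunkl mu f x)%:C).

End Dunkl.

(* Main.v *)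
Require Import Defs.
From HB Require Import structures.
From mathcomp Require Import all_boot all_order all_algebra.
From mathcomp Require Import all_classical all_reals all_analysis.
From mathcomp Require Import measurable_realfun pi_irrational.
From mathcomp Require Import complex ring lra.

(* The sequence sigma is real, because comparing imaginary parts of leading
   coefficients in the coherence relation kills its imaginary part. Coherence then
   says that T_mu maps Q = P_(n+2) + a_(n-1) P_n to a multiple of R_(n+1). Hence Q
   is Sobolev-orthogonal to all polynomials of degree < n and, by parity, to
   S_(n+1), which forces Q = S_(n+2) + eta_(n-1) S_n. Pairing this identity with f
   gives the recurrence. The pairings with f are finite since f and T_mu f are
   measurable (the derivative being a limit of difference quotients) and square
   integrable. *)

Set Implicit Arguments.
Unset Strict Implicit.
Unset Printing Implicit Defensive.

Import Order.TTheory GRing.Theory Num.Theory.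
Import numFieldNormedType.Exports.
Local Open Scope classical_set_scope.
Local Open Scope ring_scope.
Local Open Scope complex_scope.

(** * Monic orthogonal polynomials of an abstract symmetric definite form *)

Section PolynomialOPS.
Context {K : numFieldType}.
Implicit Types (p q r : {poly K}).

(** Subtracting the right multiple of the top [E k] lowers the size, so the [E k] with [k < n] span
    all polynomials of size at most [n]. *)
Lemma monic_basis_ind (E : nat -> {poly K}) (V : {poly K} -> Prop) (n : nat) :
  (forall k, E k \is monic /\ size (E k) = k.+1) ->
  V 0 -> (forall (a : K) p q, V p -> V q -> V (a *: p + q)) ->
  (forall k, (k < n)%N -> V (E k)) ->
  forall p, (size p <= n)%N -> V p.
Proof.
move=> mE V0 VL; elim: n => [|n IHn] VE p sp.
  by move: sp; rewrite leqn0 size_poly_eq0 => /eqP ->.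
have [/monicP lE sE] := mE n.
rewrite -(subrKC (p`_n *: E n) p); apply: VL; first exact: VE.
apply: IHn => [k kn|]; first by apply: VE; exact: ltnW.
apply/leq_sizeP => j; rewrite leq_eqVlt coefB coefZ => /predU1P[<-|nj].
  by move: lE; rewrite lead_coefE sE /= => ->; rewrite mulr1 subrr.
by rewrite (nth_default _ (leq_trans sp nj)) [(E n)`_j]nth_default ?sE// mulr0 subrr.
Qed.

Lemma coef_comp_polyN p i : (p \Po - 'X)`_i = (-1) ^+ i * p`_i.
Proof.
elim/poly_ind: p i => [|p c IHp] i; first by rewrite comp_poly0 coef0 mulr0.
rewrite comp_poly_MXaddC !coefD !coefC mulrN coefN !coefMX.
case: i => [|i] /=; first by rewrite oppr0 mul1r.
by rewrite IHp exprS mulN1r mulNr !addr0.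
Qed.

Lemma comp_polyNK : involutive (fun p => p \Po - 'X).
Proof. by move=> p; apply/polyP => i; rewrite !coef_comp_polyN signrMK. Qed.

Lemma size_comp_polyN p : size (p \Po - 'X) = size p.
Proof. by rewrite size_comp_poly2// size_polyN size_polyX. Qed.

(** The form stays abstract because it stands later both for the pairing with a measure and for the
    Sobolev form. *)
Variable B : {poly K} -> {poly K} -> K.
Hypotheses (BL : forall a p q r, B (a *: p + q) r = a * B p r + B q r)
  (BC : forall p q, B p q = B q p)
  (B_def : forall p, B p p = 0 -> p = 0).

Lemma form_linr (a : K) p q r : B p (a *: q + r) = a * B p q + B p r.
Proof. by rewrite ![B p _]BC BL. Qed.

Lemma form_0l p : B 0 p = 0.
Proof. by have := BL (-1) p p p; rewrite scaleN1r addNr mulN1r addNr. Qed.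

Variable S : nat -> {poly K}.
Hypotheses (S_monic : forall k, S k \is monic /\ size (S k) = k.+1)
  (S_orth : forall m n, m != n -> B (S m) (S n) = 0).

Lemma orth_lower p n : (size p <= n)%N -> B (S n) p = 0.
Proof.
move: p; apply: (monic_basis_ind S_monic) => [|a p q Bp Bq|k kn].
- by rewrite BC form_0l.
- by rewrite form_linr Bp Bq mulr0 addr0.
- by rewrite S_orth// gtn_eqF.
Qed.

(** [p] is orthogonal to a basis of a space that contains it, hence to itself. *)
Lemma orth_eq0 p n : (size p <= n)%N -> (forall k, (k < n)%N -> B p (S k) = 0) ->
  p = 0.
Proof.
move=> sp Bp; apply: B_def; suff Bpq q : (size q <= n)%N -> B p q = 0 by exact: Bpq.
move: q; apply: (monic_basis_ind S_monic) => [|a q r Bq Br|k kn].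
- by rewrite BC form_0l.
- by rewrite form_linr Bq Br mulr0 addr0.
- exact: Bp.
Qed.

Section Reflection.
Hypothesis B_comp_polyN : forall p q, B (p \Po - 'X) (q \Po - 'X) = B p q.

(** Leading coefficients cancel in the difference of the two sides, so its size is at most [n].
    Invariance of the form moves the reflection onto [S k], so the difference is orthogonal to every
    [S k] with [k < n]. *)
Lemma orth_parity n : S n \Po - 'X = (-1) ^+ n *: S n.
Proof.
apply/eqP; rewrite -subr_eq0; apply/eqP; apply: (@orth_eq0 _ n).
  have [/monicP lS sS] := S_monic n.
  apply/leq_sizeP => j; rewrite leq_eqVlt coefB coefZ coef_comp_polyN.
  move=> /predU1P[<-|nj]; first by rewrite subrr.
  by rewrite [(S n)`_j]nth_default ?sS// !mulr0 subrr.
move=> k kn; rewrite addrC -scaleNr BL (S_orth (negbT (gtn_eqF kn))) mulr0 add0r.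
rewrite -B_comp_polyN comp_polyNK orth_lower// size_comp_polyN.
by have [_ ->] := S_monic k.
Qed.

(** Reflecting both arguments preserves the value but also flips its sign, so the value is its own
    opposite. *)
Lemma orth_opp_parity p k n : odd k != odd n ->
  p \Po - 'X = (-1) ^+ n *: p -> B p (S k) = 0.
Proof.
move=> kn pn; have := B_comp_polyN p (S k).
rewrite orth_parity pn -signr_odd -(signr_odd _ k).
move: kn; case: (odd k); case: (odd n) => // _; rewrite expr1 expr0 scale1r scaleN1r.
  rewrite BC -scaleN1r -[_ *: _]addr0 BL form_0l addr0 mulN1r (BC _ p) => /eqP.
  by rewrite eq_sym -addr_eq0 -mulr2n mulrn_eq0 => /eqP.
rewrite -scaleN1r -[_ *: _]addr0 BL form_0l addr0 mulN1r => /eqP.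
by rewrite eq_sym -addr_eq0 -mulr2n mulrn_eq0 => /eqP.
Qed.
End Reflection.
End PolynomialOPS.

(** * Action of the Dunkl operator on polynomials *)

Section DunklPolynomial.
Context {K : realType}.
Implicit Types (mu : K) (p q : {poly K}).

Definition dunkl_poly mu p : {poly K} :=
  p^`() + (2 * mu) *: (odd_poly p \Po 'X^2).

Lemma horner_odd_part p x :
  p.[x] - p.[- x] = 2 * x * (odd_poly p \Po 'X^2).[x].
Proof.
rewrite -{1 2}(poly_even_odd p) !(hornerD, hornerM, hornerX, horner_comp, hornerXn).
by rewrite mulrNN; ring.
Qed.

Lemma odd_quotient_horner p x :
  odd_quotient (horner p) x = (odd_poly p \Po 'X^2).[x].
Proof.
rewrite /odd_quotient; case: eqVneq => [->|x0]; last first.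
  by rewrite horner_odd_part; field.
apply/cvg_lim => //.
apply: (@cvg_trans _ ((odd_poly p \Po 'X^2).[y] @[y --> 0^'])).
  apply: near_eq_cvg; near=> y.
  have y0 : y != 0 by near: y; exact: nbhs_dnbhs_neq.
  by rewrite horner_odd_part; field.
apply: cvg_within_filter.
exact: (@continuous_horner _ (odd_poly p \Po 'X^2) 0).
Unshelve. all: by end_near. Qed.

Lemma dunkl_horner mu p : dunkl mu (horner p) = horner (dunkl_poly mu p).
Proof.
apply/funext => x.
by rewrite /dunkl odd_quotient_horner -derivE hornerD hornerZ.
Qed.

(** The rule sending x^n to mu_n x^(n-1), read on coefficients; linearity, degree drop and parity
    follow from it. *)
Lemma coef_dunkl_poly mu p i :
  (dunkl_poly mu p)`_i = dunkl_num mu i.+1 * p`_i.+1.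
Proof.
rewrite coefD coefZ coef_deriv coef_comp_poly_Xn// dvdn2 -mulr_natl /dunkl_num.
rewrite -signr_odd /= coef_odd_poly.
have [oi|ei] := boolP (odd i) => /=; first by rewrite expr0; ring.
have -> : ((i %/ 2).*2 = i)%N by rewrite divn2 halfK (negbTE ei) subn0.
by rewrite expr1; ring.
Qed.

Lemma dunkl_poly_linear mu (a : K) p q :
  dunkl_poly mu (a *: p + q) = a *: dunkl_poly mu p + dunkl_poly mu q.
Proof. by apply/polyP => i; rewrite !(coefD, coefZ, coef_dunkl_poly); ring. Qed.

Lemma size_dunkl_poly mu p n : (size p <= n.+1)%N -> (size (dunkl_poly mu p) <= n)%N.
Proof.
move=> sp; apply/leq_sizeP => j nj.
by rewrite coef_dunkl_poly nth_default ?mulr0// (leq_trans sp).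
Qed.

(** The operator lowers each degree by one, which costs one sign. *)
Lemma dunkl_poly_comp_polyN mu p :
  dunkl_poly mu (p \Po - 'X) = - (dunkl_poly mu p \Po - 'X).
Proof.
apply/polyP => i; rewrite coefN !(coef_comp_polyN, coef_dunkl_poly) exprS.
by ring.
Qed.

Lemma dunkl_num_neq0 mu n : dunkl_admissible mu -> dunkl_num mu n.+1 != 0.
Proof.
move=> hmu; rewrite /dunkl_num -signr_odd /=.
have [on|en] := boolP (odd n) => /=.
  by rewrite expr0 subrr mulr0 addr0 pnatr_eq0.
(* For even [n] the number is n + 1 + 2 mu; its vanishing would give mu = -n/2 - 1/2, excluded by
   admissibility at [n./2]. *)
apply: contraNneq (hmu n./2) => /eqP.
rewrite -[X in X.+1%:R](odd_double_half n) (negPf en) add0n -natr1 -muln2 natrM.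
move=> /eqP h; apply/eqP; move: h; rewrite expr1 => h; lra.
Qed.
End DunklPolynomial.

(** * Measurability, integrability and the pairing with a measure *)

Section Pairing.
Context {K : realType}.
Implicit Types (u : probability (measurableTypeR K) K) (p q r : {poly K}).
Implicit Types (f g : K -> K).

(** The derivative need not be continuous, but it is the pointwise limit of the difference quotients
    with steps [harmonic n], which are measurable. *)
Lemma measurable_derive1 f : (forall x, derivable f x 1) ->
  measurable_fun setT (derive1 f : K -> K).
Proof.
move=> df.
have mf : measurable_fun setT f.
  apply: continuous_measurable_fun => x.
  exact/differentiable_continuous/derivable1_diffP.
apply: (@measurable_fun_cvg _ (measurableTypeR K) K setT
  (fun n x => (harmonic n)^-1 * (f (harmonic n + x) - f x))).
  move=> n; apply: measurable_funM; first exact: measurable_cst.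
  apply: measurable_funB => //; apply: measurableT_comp => //.
  by apply: measurable_funD; [exact: measurable_cst|exact: measurable_id].
move=> x _.
pose d h := h^-1 * (f (h + x) - f x).
have dx : d h @[h --> 0^'] --> derive1 f x.
  have := df x; rewrite /derivable => /cvg_ex[l hl].
  have hd : d h @[h --> 0^'] --> l.
    by move: hl; under eq_cvg do rewrite /= [_%:A]mulr1.
  by rewrite /derive1 (cvg_lim _ hd).
have /cvg_at_rightP := cvg_dnbhs_at_right dx.
apply; split => [n|]; first exact: harmonic_gt0.
exact: cvg_harmonic.
Qed.

(** The function is a constant at the point 0 and continuous on the open complement. *)
Lemma measurable_odd_quotient f : (forall x, derivable f x 1) ->
  measurable_fun setT (odd_quotient f).
Proof.
move=> df.
have cf x : f y @[y --> x] --> f x.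
  exact/differentiable_continuous/derivable1_diffP.
apply: measurable_fun_if => //.
- by apply: measurable_fun_eqr; [exact: measurable_id|exact: measurable_cst].
rewrite setTI (_ : _ @^-1` _ = [set x | x != 0]); last first.
  by apply/seteqP; split => x /=; case: eqP.
apply: open_continuous_measurable_fun; first exact: open_neq.
move=> x; rewrite inE /= => x0.
apply: cvgM.
  apply: cvgB; first exact: cf.
  apply: (@cvg_comp _ _ _ (fun y => - y) f _ (nbhs (- x))); last exact: cf.
  exact: opp_continuous.
apply: cvgV; first by rewrite mulf_neq0.
by apply: cvgM; [exact: cvg_cst|exact: cvg_id].
Qed.

Lemma measurable_dunkl mu f : (forall x, derivable f x 1) ->
  measurable_fun setT (dunkl mu f).
Proof.
move=> df; apply: measurable_funD; first exact: measurable_derive1.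
by apply: measurable_funM; [exact: measurable_cst|exact: measurable_odd_quotient].
Qed.

(** Measurability of [f] is listed apart, since integrability of the square yields only that of the
    square. *)
Definition square_integrable u f :=
  measurable_fun setT f /\ u.-integrable setT (EFin \o (fun x => f x ^+ 2)).

Lemma measurable_square f : measurable_fun setT f ->
  measurable_fun setT (fun x => f x ^+ 2).
Proof. by move=> mf; under eq_fun do rewrite expr2; exact: measurable_funM. Qed.

(** Domination by |f g| <= f^2 + g^2. *)
Lemma square_integrableM u f g : square_integrable u f -> square_integrable u g ->
  u.-integrable setT (EFin \o (fun x => f x * g x)).
Proof.
move=> [mf f2] [mg g2].
apply: (le_integrable _ _ _ (integrableD measurableT f2 g2)) => //.
  by apply/measurable_EFinP; exact: measurable_funM.
move=> x _ /=; rewrite lee_fin [leRHS]ger0_norm; last first.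
  by rewrite addr_ge0 ?sqr_ge0.
by rewrite ler_norml; apply/andP; split; nra.
Qed.

Lemma square_integrable_lty u f : measurable_fun setT f ->
  (\int[u]_x (f x ^+ 2)%:E < +oo)%E -> square_integrable u f.
Proof.
move=> mf f2; split => //; apply/integrableP; split.
  by apply/measurable_EFinP; exact: measurable_square.
by under eq_integral do rewrite /= ger0_norm ?sqr_ge0//.
Qed.

Lemma integrable_horner u p : has_finite_moments u ->
  u.-integrable setT (EFin \o horner p).
Proof.
move=> mom_u; move: (leqnn (size p)); move: {1 3}p.
apply: (@monic_basis_ind _ (fun n => 'X^n)
  (fun q => u.-integrable setT (EFin \o horner q))) => [k||a q r iq ir|k _].
- by rewrite monicXn size_polyXn.
- rewrite (_ : EFin \o _ = cst 0%E); first exact: integrable0.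
  by apply/funext => x /=; rewrite horner0.
- have := integrableD measurableT (integrableZl measurableT a iq) ir.
  apply: eq_integrable => // x _ /=.
  by rewrite hornerD hornerZ EFinD EFinM.
- by have := mom_u k; apply: eq_integrable => // x _ /=; rewrite hornerXn.
Qed.

Lemma square_integrable_horner u p : has_finite_moments u ->
  square_integrable u (horner p).
Proof.
move=> mom_u; split; first exact: measurable_poly.
have := integrable_horner (p ^+ 2) mom_u.
by apply: eq_integrable => // x _ /=; rewrite horner_exp.
Qed.

Lemma pairing_linear u (a : K) f g :
  u.-integrable setT (EFin \o f) -> u.-integrable setT (EFin \o g) ->
  pairing u (fun x => a * f x + g x) = a * pairing u f + pairing u g.
Proof.
move=> uf ug; rewrite /pairing RintegralD// ?RintegralZl//.
by have := integrableZl measurableT a uf; apply: eq_integrable.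
Qed.

Lemma pairing_cst0 u : pairing u (cst 0) = 0.
Proof. by rewrite /pairing Rintegral_cst// mul0r. Qed.

Lemma pairing_horner0 u : pairing u (horner 0) = 0.
Proof.
by rewrite -(pairing_cst0 u); congr pairing; apply/funext => x; rewrite horner0.
Qed.

Lemma pairing_horner_linear u (a : K) p q : has_finite_moments u ->
  pairing u (horner (a *: p + q)) = a * pairing u (horner p) + pairing u (horner q).
Proof.
move=> mom_u; rewrite -pairing_linear; [|exact: integrable_horner..].
by congr pairing; apply/funext => x; rewrite hornerD hornerZ.
Qed.

(** Reflection flips the sign of the odd monomials only, and their moments vanish. *)
Lemma pairing_horner_comp_polyN u p : admissible_measure u ->
  pairing u (horner (p \Po - 'X)) = pairing u (horner p).
Proof.
move=> [mom_u _ [_ oddu]]; move: (leqnn (size p)); move: {1 3 4}p.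
apply: (@monic_basis_ind _ (fun n => 'X^n)
  (fun q => pairing u (horner (q \Po - 'X)) = pairing u (horner q)))
  => [k||a q r uq ur|k _].
- by rewrite monicXn size_polyXn.
- by rewrite comp_poly0.
- by rewrite comp_polyD comp_polyZ !pairing_horner_linear// uq ur.
- rewrite comp_Xn_poly exprNn -signr_odd.
  have [ok|ek] := boolP (odd k); last by rewrite expr0 mul1r.
  have Xk0 : pairing u (horner 'X^k) = 0.
    rewrite -(oddu k./2); congr pairing; apply/funext => x.
    by rewrite hornerXn -[in LHS](odd_double_half k) ok.
  rewrite expr1 mulN1r -scaleN1r -[_ *: _]addr0 pairing_horner_linear// Xk0.
  by rewrite mulr0 add0r pairing_horner0.
Qed.

Lemma pairing_horner_ge0 u p : 0 <= pairing u (horner (p * p)).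
Proof. by apply: Rintegral_ge0 => x _; rewrite hornerM -expr2 sqr_ge0. Qed.

(* The open set where [p] does not vanish would be a null set; it meets the
   support, which is not contained in the finite set of roots of [p]. *)
Lemma pairing_horner_eq0 u p : admissible_measure u ->
  pairing u (horner (p * p)) = 0 -> p = 0.
Proof.
move=> [mom_u infu _] up0; apply/eqP/negPn/negP => p0.
have [B Bu sB] := infinite_set_fset (size p) infu.
have [/(max_poly_roots p0)/(_ (finmap.fset_uniq B))|/allPn[x xB px]] :=
  boolP (all (root p) (finmap.enum_fset B)); first by rewrite ltnNge sB.
have oU : open [set y | horner p y != 0].
  have := @open_comp _ _ (horner p) [set y | y != 0].
  by apply; [move=> y _; exact: continuous_horner|exact: open_neq].
have /= := Bu x xB _ oU px.
suff -> : u [set y | p.[y] != 0] = 0%E by rewrite ltxx.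
have ip := integrable_horner (p * p) mom_u.
have : (\int[u]_x `|(horner (p * p) x)%:E|)%E = 0%E.
  under eq_integral do
    rewrite gee0_abs ?lee_fin ?hornerM -?expr2 ?sqr_ge0// expr2 -hornerM.
  rewrite -(fineK (integrable_fin_num measurableT ip)).
  by rewrite [fine _]up0.
have mp : measurable_fun [set: measurableTypeR K] (EFin \o horner (p * p)).
  by apply/measurable_EFinP; exact: measurable_poly.
move=> /(ae_eq_integral_abs u measurableT mp) pae.
apply: measure_negligible; first exact: open_measurable.
apply: negligibleS pae => y /= py /(_ I)[/eqP].
by rewrite hornerM mulf_eq0 (negbTE py).
Qed.
End Pairing.

(** * The Sobolev form on polynomials *)

Section SobolevForm.
Context {K : realType}.
Variables (mu lam : K) (u v : probability (measurableTypeR K) K).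
Hypotheses (hlam : 0 < lam) (hu : admissible_measure u) (hv : admissible_measure v).
Implicit Types (p q r : {poly K}) (f : K -> K).

Let mom_u : has_finite_moments u. Proof. by case: hu. Qed.
Let mom_v : has_finite_moments v. Proof. by case: hv. Qed.

Lemma sobolev_horner p q : sobolev mu lam u v (horner p) (horner q) =
  pairing u (horner (p * q)) +
  lam * pairing v (horner (dunkl_poly mu p * dunkl_poly mu q)).
Proof.
rewrite /sobolev !dunkl_horner.
by congr (pairing u _ + lam * pairing v _); apply/funext => x; rewrite hornerM.
Qed.

Lemma pairing_hornerMC p q : pairing u (horner (p * q)) = pairing u (horner (q * p)).
Proof. by rewrite mulrC. Qed.

Lemma pairing_hornerM_linear (w : probability (measurableTypeR K) K) (a : K) p q r :
  has_finite_moments w ->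
  pairing w (horner ((a *: p + q) * r)) =
  a * pairing w (horner (p * r)) + pairing w (horner (q * r)).
Proof. by move=> mw; rewrite mulrDl -scalerAl pairing_horner_linear. Qed.

Lemma sobolev_horner_linear (a : K) p q r :
  sobolev mu lam u v (horner (a *: p + q)) (horner r) =
  a * sobolev mu lam u v (horner p) (horner r) +
  sobolev mu lam u v (horner q) (horner r).
Proof.
rewrite !sobolev_horner dunkl_poly_linear !pairing_hornerM_linear//.
by ring.
Qed.

Lemma sobolev_hornerC p q : sobolev mu lam u v (horner p) (horner q) =
  sobolev mu lam u v (horner q) (horner p).
Proof. by rewrite !sobolev_horner mulrC [X in _ + _ * pairing _ (horner X)]mulrC. Qed.

(** Both summands are nonnegative, so the pairing of [p * p] with [u] vanishes by itself. *)
Lemma sobolev_horner_eq0 p : sobolev mu lam u v (horner p) (horner p) = 0 -> p = 0.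
Proof.
rewrite sobolev_horner => /eqP.
rewrite paddr_eq0 ?pairing_horner_ge0// ?mulr_ge0 ?pairing_horner_ge0 ?ltW//.
by move=> /andP[/eqP pp _]; exact: pairing_horner_eq0 pp.
Qed.

(** Each Dunkl factor contributes one sign and the two cancel; both pairings are invariant under
    reflection. *)
Lemma sobolev_horner_comp_polyN p q :
  sobolev mu lam u v (horner (p \Po - 'X)) (horner (q \Po - 'X)) =
  sobolev mu lam u v (horner p) (horner q).
Proof.
rewrite !sobolev_horner !dunkl_poly_comp_polyN mulrNN -!comp_polyM.
by rewrite !pairing_horner_comp_polyN.
Qed.

(** For a general [f] linearity needs integrable products, which square integrability supplies. It
    allows a polynomial identity to be paired with [f]. *)
Lemma sobolev_linear_r f (a : K) p q :
  square_integrable u f -> square_integrable v (dunkl mu f) ->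
  sobolev mu lam u v f (horner (a *: p + q)) =
  a * sobolev mu lam u v f (horner p) + sobolev mu lam u v f (horner q).
Proof.
move=> fu fv; rewrite /sobolev !dunkl_horner dunkl_poly_linear.
have L (w : probability (measurableTypeR K) K) (g : K -> K) (p' q' : {poly K}) :
    has_finite_moments w -> square_integrable w g ->
    pairing w (fun x => g x * (a *: p' + q').[x]) =
    a * pairing w (fun x => g x * p'.[x]) + pairing w (fun x => g x * q'.[x]).
  move=> mw gw; rewrite -pairing_linear.
  - by congr pairing; apply/funext => x; rewrite hornerD hornerZ; ring.
  - exact/square_integrableM/square_integrable_horner.
  - exact/square_integrableM/square_integrable_horner.
by rewrite !L//; ring.
Qed.

(** * Expansion of P_(n+2) + a P_n in the Sobolev orthogonal polynomials *)

Section Recurrence.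
Variables (P S : nat -> {poly K}).
Hypotheses (hP : monic_OPS u P) (hS : monic_sobolev_OPS mu lam u v S).

Let P_monic := hP.1.
Let S_monic := hS.1.

Let P_orth m n : m != n -> pairing u (horner (P m * P n)) = 0.
Proof.
move=> mn; rewrite -(hP.2 _ _ mn); congr pairing; apply/funext => x.
by rewrite hornerM.
Qed.

Let uL (a : K) p q r := pairing_hornerM_linear a p q r mom_u.

Lemma P_orth_lower p n : (size p <= n)%N -> pairing u (horner (P n * p)) = 0.
Proof. exact: (orth_lower uL pairing_hornerMC P_monic P_orth). Qed.

Lemma P_parity n : P n \Po - 'X = (-1) ^+ n *: P n.
Proof.
apply: (orth_parity uL pairing_hornerMC _ P_monic P_orth) => [p|p q].
  exact: pairing_horner_eq0.
by rewrite -comp_polyM pairing_horner_comp_polyN.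
Qed.

Lemma S_parity n : S n \Po - 'X = (-1) ^+ n *: S n.
Proof.
exact: (orth_parity sobolev_horner_linear sobolev_hornerC sobolev_horner_eq0
  S_monic hS.2 sobolev_horner_comp_polyN).
Qed.

Lemma sobolev_S_neq0 n : sobolev mu lam u v (horner (S n)) (horner (S n)) != 0.
Proof.
apply/eqP => /sobolev_horner_eq0 Sn0; have [_] := S_monic n.
by rewrite Sn0 size_poly0.
Qed.

(** Both polynomials are monic of degree [n], so [S n - P n] has lower degree and is orthogonal to
    [P n]. This is the source of p_n in the numerator of eta. *)
Lemma pairing_P_S n :
  pairing u (horner (P n * S n)) = pairing u (fun x => (P n).[x] ^+ 2).
Proof.
rewrite -(subrKC (P n) (S n)) mulrDr -[_ + _]scale1r.
have -> : pairing u (fun x => (P n).[x] ^+ 2) = pairing u (horner (P n * P n)).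
  by congr pairing; apply/funext => x; rewrite hornerM expr2.
rewrite scale1r -[P n * P n]scale1r pairing_horner_linear// scale1r mul1r.
rewrite [X in _ + X]P_orth_lower ?addr0//.
have [/monicP lP sP] := P_monic n; have [/monicP lS sS] := S_monic n.
apply/leq_sizeP => j; rewrite leq_eqVlt coefB => /predU1P[<-|nj].
  by move: lP lS; rewrite !lead_coefE sP sS /= => -> ->; rewrite subrr.
by rewrite !nth_default ?subrr ?sP ?sS.
Qed.

(* The difference of the two sides has degree at most [n + 1]. Its product with
   [S k] vanishes for [k < n] by orthogonality, for [k = n] by the choice of the
   coefficient, and for [k = n + 1] by parity. *)
Lemma sobolev_OPS_recurrence (a : K) n :
  (forall p, (size p <= n)%N ->
    pairing v (horner (dunkl_poly mu (P n.+2 + a *: P n) * p)) = 0) ->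
  P n.+2 + a *: P n = S n.+2 +
    (pairing u (fun x => (P n).[x] ^+ 2) /
     sobolev mu lam u v (horner (S n)) (horner (S n)) * a) *: S n.
Proof.
move=> vT; set Q := P n.+2 + _; set eta := _ * a.
have BL := sobolev_horner_linear; have BC := sobolev_hornerC.
(* For [k <= n] the Dunkl image of [S k] has size at most [n], so the hypothesis on [v] removes the
   second term; in the first, [P n.+2] is orthogonal to [S k]. *)
have BQ k : (k <= n)%N -> sobolev mu lam u v (horner Q) (horner (S k)) =
    a * pairing u (horner (P n * S k)).
  move=> kn; have [_ sS] := S_monic k.
  rewrite sobolev_horner vT ?mulr0 ?addr0; last first.
    by apply: leq_trans kn; apply: size_dunkl_poly; rewrite sS.
  rewrite /Q addrC pairing_hornerM_linear// (@P_orth_lower _ n.+2) ?addr0//.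
  by rewrite sS; exact: leq_trans kn _.
have QP : Q \Po - 'X = (-1) ^+ n *: Q.
  rewrite /Q comp_polyD comp_polyZ !P_parity !exprS !mulN1r opprK.
  by rewrite scalerDr !scalerA mulrC.
suff : (- eta) *: S n + (Q - S n.+2) = 0.
  move=> /eqP; rewrite scaleNr addrC subr_eq0 => /eqP <-.
  by rewrite subrKC.
apply: (orth_eq0 (n := n.+2) BL BC sobolev_horner_eq0 S_monic) => [|k].
  have [/monicP lP sP] := P_monic n.+2; have [/monicP lS sS] := S_monic n.+2.
  apply/leq_sizeP => j nj.
  rewrite !(coefD, coefZ, coefN) [(S n)`_j]nth_default ?(S_monic n).2 1?ltnW//.
  rewrite [(P n)`_j]nth_default ?(P_monic n).2 1?ltnW// !mulr0 add0r addr0.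
  move: nj; rewrite leq_eqVlt => /predU1P[<-|nj].
    by move: lP lS; rewrite !lead_coefE sP sS /= => -> ->; rewrite subrr.
  by rewrite !nth_default ?subrr ?sP ?sS.
rewrite ltnS => kn; rewrite BL [Q - _]addrC -[- S n.+2]scaleN1r BL.
rewrite (hS.2 n.+2 k) ?gtn_eqF ?ltnS//.
move: kn; rewrite leq_eqVlt => /predU1P[->|kn].
  rewrite hS.2 ?ltn_eqF// !mulr0 !add0r.
  apply: (orth_opp_parity BL BC sobolev_horner_eq0 S_monic hS.2
    sobolev_horner_comp_polyN _ QP).
  by rewrite /=; case: (odd n).
rewrite BQ//; move: kn; rewrite ltnS leq_eqVlt => /predU1P[->|kn].
  by rewrite pairing_P_S /eta; field; exact: sobolev_S_neq0.
rewrite hS.2 ?gtn_eqF// P_orth_lower ?(S_monic k).2//.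
by rewrite !mulr0 !addr0.
Qed.
End Recurrence.
End SobolevForm.

(** * From complex coherence coefficients to real ones *)

Section ComplexCoefficients.
Context {K : realType}.
Implicit Types (u v : probability (measurableTypeR K) K).

(** The [size p] naturals below [size p] would be distinct roots, too many for a nonzero [p]. This
    turns the pointwise coherence relation into polynomial identities. *)
Lemma horner_all0 (p : {poly K}) : (forall x, p.[x] = 0) -> p = 0.
Proof.
move=> px; apply/eqP/negPn/negP => p0.
have := max_poly_roots (rs := [seq i%:R | i <- iota 0 (size p)]) p0.
rewrite size_map size_iota ltnn => H.
suff : false by [].
apply: H; first by apply/allP => x _; apply/rootP.
by rewrite map_inj_uniq ?iota_uniq// => i j /eqP; rewrite eqr_nat => /eqP.
Qed.

(** Coherence is used at index [n.+2]: its imaginary part kills that of sigma_(n+1), since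
    [dunkl_num mu n.+1] is nonzero, and its real part scaled by [dunkl_num mu n.+3] is the
    polynomial identity. *)
Lemma coherent_a_coef_real mu u v (P R : nat -> {poly K}) (sigma : nat -> K[i]) n :
  dunkl_admissible mu -> symmetric_coherent_pair mu u v P R sigma ->
  exists2 a : K, a_coef mu sigma n = a%:C &
    dunkl_poly mu (P n.+3 + a *: P n.+1) = dunkl_num mu n.+3 *: R n.+2.
Proof.
move=> hmu [_ _ [Pm _] _ [_ coh]].
have m1 : dunkl_num mu n.+1 != 0 by exact: dunkl_num_neq0.
have m3 : dunkl_num mu n.+3 != 0 by exact: dunkl_num_neq0.
have {coh} := coh n.+2 isT; rewrite /a_coef /eps_coef /=.
case: (sigma n.+1) => s t coh.
have t0 : t = 0.
  have /(congr1 (fun p : {poly K} => p`_n)) : t *: dunkl_poly mu (P n.+1) = 0.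
    apply: horner_all0 => x; have /(congr1 (@complex.Im K)) /= := coh x.
    rewrite dunkl_horner hornerZ mulr0 !add0r => /eqP.
    by rewrite eq_sym oppr_eq0 mulrA mulf_eq0 invr_eq0 (negPf m1) orbF => /eqP.
  have [/monicP lP sP] := Pm n.+1; move: lP; rewrite lead_coefE sP /= => lP.
  rewrite coefZ coef_dunkl_poly lP mulr1 coef0 => /eqP.
  by rewrite mulf_eq0 (negPf m1) orbF => /eqP.
(* The witness is [a_coef] with sigma_(n+1) replaced by its real part [s]; the sign comes from
   [eps_coef]. *)
exists (- (dunkl_num mu n.+3 / dunkl_num mu n.+1 * s)).
  by rewrite t0 -[s +i* 0]/(s%:C) -rmorphN -rmorphM mulrN.
apply/eqP; rewrite -subr_eq0; apply/eqP/horner_all0 => x.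
have /(congr1 (@complex.Re K)) /= := coh x.
rewrite !dunkl_horner t0 mul0r subr0 => Rx.
rewrite [P n.+3 + _]addrC dunkl_poly_linear.
rewrite hornerD hornerN !hornerZ Rx hornerD hornerZ; field.
by rewrite m1 m3.
Qed.

Lemma cpairing_real u (g : K -> K) :
  cpairing u (fun x => (g x)%:C) = (pairing u g)%:C.
Proof. by rewrite /cpairing /= [X in _ +i* X](pairing_cst0 u). Qed.

Lemma w_coef_real mu lam u v (P : nat -> {poly K}) sigma f n (a : K) :
  lag (a_coef mu sigma) n = a%:C ->
  w_coef mu lam u v P sigma f n =
  (sobolev mu lam u v f (horner (P n.+2 + a *: P n)))%:C.
Proof.
move=> ha; rewrite /w_coef ha.
under [X in cpairing u X]eq_fun do rewrite -!(rmorphM, rmorphD).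
under [X in cpairing v X]eq_fun do rewrite -!(rmorphM, rmorphD).
rewrite !cpairing_real -rmorphM -rmorphD; congr (_%:C); rewrite /sobolev.
congr (pairing u _ + lam * pairing v _); apply/funext => x.
  by rewrite hornerD hornerZ mulrC.
rewrite [P n.+2 + _]addrC !dunkl_horner dunkl_poly_linear [X in _ = _ * X]hornerD.
by rewrite hornerZ; ring.
Qed.
End ComplexCoefficients.

(** * The recurrence for the Sobolev coefficients and its initial values *)

Theorem lemma5p1 (K : realType) (mu lam : K)
    (u v : probability (measurableTypeR K) K)
    (P R S : nat -> {poly K}) (sigma : nat -> K[i]) (f : K -> K)
    (hmu : dunkl_admissible mu) (hlam : 0 < lam)
    (huv : symmetric_coherent_pair mu u v P R sigma)
    (hS : monic_sobolev_OPS mu lam u v S)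
    (hf : sobolev_space mu lam u v f) :
  (forall n : nat,
     (sobolev_coef mu lam u v S f n.+2)%:C
     + lag (eta_coef mu lam u v P S sigma) n * (sobolev_coef mu lam u v S f n)%:C
     = w_coef mu lam u v P sigma f n) /\
  [/\ lag (eta_coef mu lam u v P S sigma) 0 = 0,
      sobolev_coef mu lam u v S f 0 = sobolev mu lam u v f (fun=> 1)
      /\ sobolev mu lam u v f (fun=> 1) = pairing u f,
      sobolev_coef mu lam u v S f 1
      = pairing u (fun x => x * f x)
        + lam * dunkl_num mu 1 * pairing v (dunkl mu f) &
      w_coef mu lam u v P sigma f 0
      = (pairing u (fun x => (P 2%N).[x] * f x)
         + lam * pairing v (fun x => dunkl mu (horner (P 2%N)) x * dunkl mu f x))%:C].
Proof.
have [hu hv hP hR _] := huv; have [df f2] := hf.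
have [mom_u _ _] := hu; have [mom_v _ _] := hv.
have mf : measurable_fun setT f.
  apply: continuous_measurable_fun => x.
  exact/differentiable_continuous/derivable1_diffP.
have fu0 : (0 <= \int[u]_x (f x ^+ 2)%:E)%E.
  by apply: integral_ge0 => x _; rewrite lee_fin sqr_ge0.
have fv0 : (0 <= \int[v]_x (dunkl mu f x ^+ 2)%:E)%E.
  by apply: integral_ge0 => x _; rewrite lee_fin sqr_ge0.
have fu : square_integrable u f.
  apply: square_integrable_lty => //; apply: le_lt_trans f2.
  by rewrite leeDl// mule_ge0// lee_fin ltW.
have fv : square_integrable v (dunkl mu f).
  apply: square_integrable_lty; first exact: measurable_dunkl.
  have : (lam%:E * \int[v]_x (dunkl mu f x ^+ 2)%:E < +oo)%E.
    by apply: le_lt_trans f2; rewrite leeDr.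
  rewrite !ltey; apply: contra => /eqP ->.
  by rewrite gt0_muley// lte_fin.
(* [S 1] is monic of degree 1 and odd, so its constant term is its own opposite. *)
have S1 : S 1 = 'X.
  have := S_parity hlam hu hv hS 1.
  have [/monicP lS sS] := hS.1 1%N => /(congr1 (fun p : {poly K} => p`_0)).
  rewrite coef_comp_polyN coefZ expr0 mul1r expr1 mulN1r => /eqP.
  rewrite eq_sym -subr_eq0 -opprD oppr_eq0 -mulr2n mulrn_eq0 /= => /eqP S10.
  apply/polyP => -[|[|i]]; rewrite coefX//=.
    by move: lS; rewrite lead_coefE sS.
  by rewrite nth_default ?sS.
have S0 : S 0 = 1.
  have [/monicP lS sS] := hS.1 0%N.
  apply/polyP => -[|i]; rewrite coef1/=.
    by move: lS; rewrite lead_coefE sS.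
  by rewrite nth_default ?sS.
have h1 : (fun=> 1 : K) = horner (1 : {poly K}).
  by apply/funext => x; rewrite hornerC.
split; last split => //.
- move=> n.
  have [a ha aT] : exists2 a : K, lag (a_coef mu sigma) n = a%:C &
      forall p : {poly K}, (size p <= n)%N ->
        pairing v (horner (dunkl_poly mu (P n.+2 + a *: P n) * p)) = 0.
    case: n => [|n].
      (* The convention a_(-1) = 0 gives the witness, and 0 is the only polynomial of size at most
         0. *)
      exists 0 => // p; rewrite leqn0 size_poly_eq0 => /eqP ->.
      by rewrite mulr0 pairing_horner0.
    have [a ha TQ] := coherent_a_coef_real n hmu huv; exists a => // p sp.
    rewrite TQ -[_ * p]addr0 -scalerAl pairing_horner_linear//.
    rewrite (P_orth_lower hv hR) 1?ltnW//.
    by rewrite mulr0 add0r pairing_horner0.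
  (* The expansion is now paired with [f]; it remains to identify its real coefficient with
     eta_(n-1). *)
  rewrite (w_coef_real _ _ _ _ _ ha) (sobolev_OPS_recurrence hlam hu hv hP hS aT).
  rewrite [S n.+2 + _]addrC (sobolev_linear_r _ hu hv _ _ _ fu fv)//.
  rewrite addrC [RHS]rmorphD; congr (_ + _); rewrite [RHS]rmorphM; congr (_ * _).
  case: n ha {aT} => [|n] /= ha.
    by move: ha => [<-]; rewrite mulr0.
  by rewrite /eta_coef ha -rmorphM.
- rewrite /sobolev_coef S0 -h1; split=> //.
  rewrite h1 /sobolev dunkl_horner.
  have -> : dunkl_poly mu 1 = 0.
    by apply/polyP => i; rewrite coef_dunkl_poly coef1 coef0 mulr0.
  rewrite [X in _ + _ * X](_ : _ = 0) ?mulr0 ?addr0.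
    by congr pairing; apply/funext => x; rewrite hornerC mulr1.
  by rewrite -(pairing_cst0 v); congr pairing; apply/funext => x; rewrite horner0 mulr0.
- rewrite /sobolev_coef S1 /sobolev dunkl_horner.
  have -> : dunkl_poly mu 'X = (dunkl_num mu 1)%:P.
    apply/polyP => i; rewrite coef_dunkl_poly coefX coefC eqSS.
    by case: eqP => [->|_]; rewrite ?mulr1 ?mulr0.
  congr (_ + _); first by congr pairing; apply/funext => x; rewrite hornerX mulrC.
  rewrite -mulrA; congr (_ * _); rewrite /pairing.
  under eq_Rintegral do rewrite hornerC.
  rewrite RintegralZr//; first by rewrite mulrC.
  (* Integrability of the Dunkl image of [f] comes from its product with the square integrable
     constant 1. *)
  have := square_integrableM fv (square_integrable_horner 1 mom_v).
  by apply: eq_integrable => // x _ /=; rewrite hornerC mulr1.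
- rewrite (@w_coef_real _ _ _ _ _ _ _ _ _ 0)// scale0r addr0.
  congr (_%:C); rewrite /sobolev.
  by congr (pairing u _ + lam * pairing v _); apply/funext => x; rewrite mulrC.
Qed.
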